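(* Let $G$ be a finite connected non oriented graph with $|E|\ge 1$ edges (multiple edges and loops allowed) and no vertices of degree one. For $N\ge 1$ let $\omega(N)$ be the number of covering cycles of length $N$ in $G$ and let $\Theta(N)$ be the number of equivalence classes of non periodic covering cycles of length $N$ in $G$. For $0\le k\le|E|$ let $\{G_k\}$ denote the family of graphs obtained from $G$ by deleting $k$ distinct edges (one graph for each $k$-element subset of the edge set; $G_0:=G$), and let $T_{G_k}$ be the edge adjacency matrix of $G_k$. Define $$h(z):=\sum_{N=1}^{\infty}\frac{\omega(N)}{N}z^N .$$ Then, as formal power series in $z$, and for each of the two choices of sign (upper signs together, lower signs together), $$\prod_{N=1}^{+\infty}(1-z^N)^{\pm\Theta(N)}=e^{\mp h(z)}=\prod_{k=0}^{|E|}\prod_{\{G_k\}}\left[\det(1-zT_{G_k})\right]^{\pm(-1)^k}=1\mp\sum_{i=1}^{+\infty}d_{\pm}(i)\,z^i,$$ where $$d_{\pm}(i)=\sum_{m=1}^{i}\lambda_{\pm}(m)\sum_{\substack{a_1+2a_2+\cdots+ia_i=i\\ a_1+\cdots+a_i=m}}\ \prod_{k=1}^{i}\frac{(\omega(k))^{a_k}}{a_k!\,k^{a_k}},$$ the inner sum being over nonnegative integers $a_1,\dots,a_i$, with $\lambda_+(m)=(-1)^{m+1}$ and $\lambda_-(m)=+1$.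
   Context: Let $G=(V,E)$ be a non oriented graph. Fix an arbitrary orientation of its edges, giving oriented edges $e_1,\dots,e_{|E|}$, and add the opposite oriented edges $e_{|E|+i}=(e_i)^{-1}$, $1\le i\le |E|$, where $(e_i)^{-1}$ has as origin the end of $e_i$ and as end the origin of $e_i$ (for a loop $e_i$, $e_{|E|+i}$ is an additional oriented loop at the same vertex, distinct from $e_i$); set $(e_{|E|+i})^{-1}=e_i$. Cycle of length $N$ in $G$: an ordered sequence $(e_{i_1},\dots,e_{i_N})$ of elements of $\{e_1,\dots,e_{2|E|}\}$ such that the end of $e_{i_k}$ is the origin of $e_{i_{k+1}}$ for $1\le k<N$, the end of $e_{i_N}$ is the origin of $e_{i_1}$ (closed), $e_{i_{k+1}}\neq (e_{i_k})^{-1}$ for $1\le k<N$ (non-backtracking), and $e_{i_1}\ne (e_{i_N})^{-1}$ (tail-less). Covering cycle of $G$: a cycle in which every edge of $G$ is present at least once, i.e. for each $1\le i\le |E|$ at least one of $e_i$, $(e_i)^{-1}$ occurs in the sequence. In $\omega(N)$, cycles are counted as sequences (circular permutations and inverses that differ as sequences are counted separately). A cycle $p$ is periodic if $p=q^r$ (the $r$-fold concatenation) for some cycle $q$ and some integer $r>1$; otherwise it is non periodic. Two cycles are equivalent if one is a circular permutation of the other. A cycle and its inverse $(e_{i_N}^{-1},\dots,e_{i_1}^{-1})$ are taken as distinct (inversion is not part of the equivalence relation). Edge adjacency matrix of a graph with $m$ edges: the $2m\times 2m$ matrix $T$ indexed by its oriented edges with $T_{ij}=1$ if the end of oriented edge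 $i$ is the origin of oriented edge $j$ and $j$ is not the inverse of $i$, and $T_{ij}=0$ otherwise. For the graph $G_{|E|}$ without edges, all traces of powers of $T_{G_{|E|}}$ are $0$ and $\det(1-zT_{G_{|E|}})=1$. The graphs $G_k$ may be disconnected or have vertices of degree one or zero. In $\det(1-zT)$, $1$ denotes the identity matrix. *)

(* Defs.v *)
From HB Require Import structures.
From mathcomp Require Import all_boot all_order all_algebra.
From mathcomp Require Import boolp.

Set Implicit Arguments.
Unset Strict Implicit.
Unset Printing Implicit Defensive.

Import Order.TTheory GRing.Theory Num.Theory.
Local Open Scope ring_scope.

(* Formal power series in one variable over a field:
   [f n] is the coefficient of degree [n]. *)
Record fps (R : fieldType) := FPS { fps_coef :> nat -> R }.

Notation "{ 'fps' R }" := (fps R) (format "{ 'fps'  R }") : type_scope.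

HB.instance Definition _ (R : fieldType) := gen_eqMixin {fps R}.
HB.instance Definition _ (R : fieldType) := gen_choiceMixin {fps R}.

Section FpsRing.
Variable R : fieldType.
Implicit Types (f g h : {fps R}) (m n i k : nat).

Lemma fpsP f g : (forall n, f n = g n) -> f = g.
Proof. by case: f g => [f] [g] /= /funext ->. Qed.

Definition fps_zero : {fps R} := FPS (fun=> 0).
Definition fps_opp f := FPS (fun n => - f n).
Definition fps_add f g := FPS (fun n => f n + g n).
Definition fps_one : {fps R} := FPS (fun n => (n == 0%N)%:R).
Definition fps_mul f g := FPS (fun n => \sum_(i < n.+1) f i * g (n - i)%N).

Let trunc n f : {poly R} := \poly_(i < n.+1) f i.

Let coef_trunc n f i : (i <= n)%N -> (trunc n f)`_i = f i.
Proof. by rewrite coef_poly ltnS => ->. Qed.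

Let fps_mulE n f g i : (i <= n)%N ->
  fps_mul f g i = (trunc n f * trunc n g)`_i.
Proof.
move=> le_in; rewrite coefM /=; apply: eq_bigr => j _.
by rewrite !coef_trunc // (leq_trans _ le_in) ?leq_subr // -ltnS.
Qed.

Fact fps_addA : associative fps_add.
Proof. by move=> f g h; apply: fpsP => n; rewrite /= addrA. Qed.
Fact fps_addC : commutative fps_add.
Proof. by move=> f g; apply: fpsP => n; rewrite /= addrC. Qed.
Fact fps_add0 : left_id fps_zero fps_add.
Proof. by move=> f; apply: fpsP => n; rewrite /= add0r. Qed.
Fact fps_addN : left_inverse fps_zero fps_opp fps_add.
Proof. by move=> f; apply: fpsP => n; rewrite /= addNr. Qed.

HB.instance Definition _ :=
  GRing.isZmodule.Build {fps R} fps_addA fps_addC fps_add0 fps_addN.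

Fact fps_mulC : commutative fps_mul.
Proof. by move=> f g; apply: fpsP => n; rewrite !(@fps_mulE n) // mulrC. Qed.
Fact fps_mulA : associative fps_mul.
Proof.
move=> f g h; apply: fpsP => n.
transitivity ((trunc n f * (trunc n g * trunc n h))`_n).
  rewrite coefM /=; apply: eq_bigr => i _.
  by rewrite coef_trunc -1?ltnS // -(fps_mulE (n := n)) ?leq_subr.
rewrite mulrA coefM /=; apply: eq_bigr => i _.
by rewrite coef_trunc ?leq_subr // -(fps_mulE (n := n)) // -ltnS.
Qed.
Fact fps_mul1 : left_id fps_one fps_mul.
Proof.
move=> f; apply: fpsP => n; rewrite /= big_ord_recl /= mul1r subn0.
by rewrite big1 ?addr0 // => i _; rewrite /= mul0r.
Qed.
Fact fps_mulDl : left_distributive fps_mul fps_add.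
Proof.
move=> f g h; apply: fpsP => n; rewrite /= -big_split /=.
by apply: eq_bigr => i _; rewrite mulrDl.
Qed.
Fact fps_one_neq0 : fps_one != fps_zero.
Proof.
by apply/eqP=> /(congr1 (fun f => f 0%N)) /= /eqP; rewrite oner_eq0.
Qed.

HB.instance Definition _ := GRing.Zmodule_isComNzRing.Build {fps R}
  fps_mulA fps_mulC fps_mul1 fps_mulDl fps_one_neq0.

Lemma fps0E n : (0 : {fps R}) n = 0. Proof. by []. Qed.
Lemma fps1E n : (1 : {fps R}) n = (n == 0%N)%:R. Proof. by []. Qed.
Lemma fpsNE f n : (- f) n = - f n. Proof. by []. Qed.
Lemma fpsDE f g n : (f + g) n = f n + g n. Proof. by []. Qed.
Lemma fpsME f g n : (f * g) n = \sum_(i < n.+1) f i * g (n - i)%N.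
Proof. by []. Qed.
Lemma fps_sumE (I : Type) (r : seq I) (P : pred I) (F : I -> {fps R}) n :
  (\sum_(i <- r | P i) F i) n = \sum_(i <- r | P i) F i n.
Proof. by apply: (big_morph (fun f => fps_coef f n)). Qed.

Definition fpsC (c : R) : {fps R} := FPS (fun n => if n is 0 then c else 0).
Definition fpsX : {fps R} := FPS (fun n => (n == 1%N)%:R).

Lemma fpsCM c f n : (fpsC c * f) n = c * f n.
Proof.
rewrite fpsME big_ord_recl /= subn0 big1 ?addr0 // => i _.
by rewrite /= mul0r.
Qed.

Lemma fps_expn_order f n k : f 0%N = 0 -> (n < k)%N -> (f ^+ k) n = 0.
Proof.
move=> f0; elim: k n => // k IHk n lt_nk.
rewrite exprS fpsME big_ord_recl /= f0 mul0r add0r big1 // => i _.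
rewrite IHk ?mulr0 //= /bump /= add1n.
have n_gt0 : (0 < n)%N by apply: leq_ltn_trans (ltn_ord i).
by rewrite ltnS in lt_nk; apply: leq_trans lt_nk; rewrite ltn_subrL.
Qed.

(* Geometric series: f^-1 = c^-1 * \sum_k (1 - c^-1 f)^k with c := f 0; the
   terms k > n do not contribute to the coefficient of degree n. *)
Definition fps_unit : pred {fps R} := fun f => f 0%N != 0.
Definition fps_inv f : {fps R} :=
  if f 0%N == 0 then f else
  FPS (fun n => (f 0%N)^-1 *
         \sum_(k < n.+1) ((1 - fpsC (f 0%N)^-1 * f) ^+ k) n).

Fact fps_mulVf : {in fps_unit, left_inverse 1 fps_inv *%R}.
Proof.
move=> f f0; rewrite /fps_inv (negPf f0); set c := (f 0%N)^-1.
set g := 1 - _; have g0 : g 0%N = 0.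
  by rewrite /g fpsDE fpsNE fpsCM fps1E eqxx mulVf // subrr.
rewrite mulrC; apply: fpsP => n; rewrite fpsME.
pose S : {fps R} := fpsC c * \sum_(k < n.+1) g ^+ k.
transitivity ((f * S) n).
  rewrite fpsME; apply: eq_bigr => i _; congr (_ * _).
  rewrite /S fpsCM fps_sumE /=; congr (_ * _).
  set m := (n - i)%N; have le_mn : (m <= n)%N by rewrite leq_subr.
  rewrite -(subnKC le_mn) -addSn big_split_ord /= [X in _ = _ + X]big1 ?addr0 //.
  by move=> k _; rewrite fps_expn_order // ltn_addr.
have -> : f * S = 1 - g ^+ n.+1.
  have fE : fpsC c * f = 1 - g by rewrite /g subKr.
  by rewrite /S mulrA [f * _]mulrC fE -(opprB (g ^+ n.+1)) subrX1 -mulNr (opprB g 1).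
by rewrite fpsDE fpsNE fps_expn_order // subr0.
Qed.
Fact fps_unitPl f g : g * f = 1 -> fps_unit f.
Proof.
move/(congr1 (fun h => h 0%N)); rewrite fpsME big_ord1 fps1E eqxx subnn /=.
by rewrite /fps_unit => gf1; apply/eqP=> f0; move/eqP: gf1; rewrite f0 mulr0 eq_sym oner_eq0.
Qed.
Fact fps_inv_out : {in [predC fps_unit], fps_inv =1 id}.
Proof. by move=> f; rewrite inE /fps_unit /= negbK /fps_inv => ->. Qed.

HB.instance Definition _ := GRing.ComNzRing_hasMulInverse.Build {fps R}
  fps_mulVf fps_unitPl fps_inv_out.

(* Convergence for the (z)-adic topology. *)
Definition fps_cvg (u : nat -> {fps R}) (f : {fps R}) : Prop :=
  forall n, exists M0, forall M, (M0 <= M)%N -> u M n = f n.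

(* e^f = \sum_k f^k / k!, meaningful when f 0 = 0: the terms k > n then do
   not contribute to the coefficient of degree n; see [fps_exp_cvg]. *)
Definition fps_exp f : {fps R} :=
  FPS (fun n => \sum_(k < n.+1) (f ^+ k) n / k`!%:R).

Lemma fps_exp_cvg f : f 0%N = 0 ->
  fps_cvg (fun M => \sum_(k < M) fpsC k`!%:R^-1 * f ^+ k) (fps_exp f).
Proof.
move=> f0 n; exists n.+1 => M le_nM; rewrite fps_sumE.
rewrite (eq_bigr (fun k : 'I_M => (f ^+ k) n / k`!%:R)); last first.
  by move=> k _; rewrite fpsCM mulrC.
rewrite -(subnKC le_nM) big_split_ord /= [X in _ + X]big1 ?addr0 // => k _.
by rewrite fps_expn_order ?mul0r // ltn_addr.
Qed.

End FpsRing.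

Arguments fpsX {R}.

(* A finite undirected multigraph (loops and multiple edges allowed), given
   together with an arbitrary orientation: [ends e] is the pair (origin, end)
   of the edge [e] in that orientation. *)
Record multigraph := Multigraph {
  vertex : finType;
  edge : finType;
  ends : edge -> vertex * vertex }.

(* Oriented edges: [(e, false)] is [e] with the chosen orientation and
   [(e, true)] its inverse; the two are distinct even when [e] is a loop. *)
Definition arc (G : multigraph) : finType := (edge G * bool)%type.

Section Graph.
Variable G : multigraph.
Implicit Types (d : arc G) (e : edge G) (v : vertex G) (s : seq (arc G)).

Definition arc_origin d : vertex G :=
  if d.2 then (ends d.1).2 else (ends d.1).1.
Definition arc_end d : vertex G :=
  if d.2 then (ends d.1).1 else (ends d.1).2.
Definition arc_inv d : arc G := (d.1, ~~ d.2).

Definition adjacent : rel (vertex G) :=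
  fun u v => [exists d, (arc_origin d == u) && (arc_end d == v)].
Definition graph_connected : bool := [forall u, forall v, connect adjacent u v].

(* Each loop at [v] contributes 2. *)
Definition degree v : nat := #|[set d | arc_origin d == v]|.

(* [d'] may follow [d] in a non-backtracking walk. *)
Definition follows : rel (arc G) :=
  fun d d' => (arc_end d == arc_origin d') && (d' != arc_inv d).

(* [path.cycle] also requires [follows (last s) (first s)], i.e. that the walk
   is closed and tail-less. *)
Definition is_cycle s : bool := (0 < size s)%N && path.cycle follows s.

Definition covering s : bool :=
  [forall e, ((e, false) \in s) || ((e, true) \in s)].

Definition periodic s : Prop :=
  exists (q : seq (arc G)) (r : nat),
    [/\ is_cycle q, (1 < r)%N & s = flatten (nseq r q)].

Definition circ_equiv (N : nat) : rel (N.-tuple (arc G)) :=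
  fun p q => `[< exists i : nat, tval q = rot i p >].

Definition covering_cycles (N : nat) : {set N.-tuple (arc G)} :=
  [set p : N.-tuple (arc G) | is_cycle p && covering p].

Definition nonperiodic_covering_cycles (N : nat) : {set N.-tuple (arc G)} :=
  [set p in covering_cycles N | ~~ `[< periodic p >]].

Definition omega (N : nat) : nat := #|covering_cycles N|.

Definition Theta (N : nat) : nat :=
  #|equivalence_partition (@circ_equiv N) (nonperiodic_covering_cycles N)|.

Definition delete_edges (A : {set edge G}) : multigraph :=
  @Multigraph (vertex G) {e : edge G | e \notin A} (fun x => ends (val x)).

Definition edge_adjacency (R : nzRingType) : 'M[R]_#|arc G| :=
  \matrix_(i, j) (follows (enum_val i) (enum_val j))%:R.

Definition h_series : {fps rat} :=
  FPS (fun N => if N is 0 then 0 else (omega N)%:R / N%:R).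

(* [upper = true] is the choice of the upper signs. *)
Definition lambda (upper : bool) (m : nat) : rat :=
  if upper then (-1) ^+ m.+1 else 1.

(* The unknown a_k of the inner sum is [a (k-1)], so that the index shifts by
   one; a_1 + 2 a_2 + ... + i a_i = i forces a_k <= i, whence a : 'I_i -> 'I_i.+1. *)
Definition d_coef (upper : bool) (i : nat) : rat :=
  \sum_(1 <= m < i.+1) lambda upper m *
    \sum_(a : {ffun 'I_i -> 'I_i.+1} |
            (\sum_(k < i) k.+1 * a k == i)%N && (\sum_(k < i) a k == m)%N)
      \prod_(k < i) ((omega k.+1)%:R ^+ a k / ((a k)`!%:R * k.+1%:R ^+ a k)).

Definition d_series (upper : bool) : {fps rat} :=
  FPS (fun i => if i is 0 then 0 else d_coef upper i).

End Graph.

Arguments edge_adjacency : clear implicits.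

(* Main.v *)
From HB Require Import structures.
Require Import Defs.
From mathcomp Require Import all_boot all_order all_algebra.
From mathcomp Require Import boolp.
From mathcomp Require Import ring.

Set Implicit Arguments.
Unset Strict Implicit.
Unset Printing Implicit Defensive.

Import Order.TTheory GRing.Theory Num.Theory.
Local Open Scope ring_scope.

(** All three expressions are power series with constant term 1, and over a
    field of characteristic 0 such a series F is determined by its logarithmic
    derivative L, the solution of F' = F L; this relation is [log_deriv F L].
    Products add logarithmic derivatives and integer powers multiply them, so
    the infinite product, the exponential and the product of determinants are
    equal as soon as the coefficients of their logarithmic derivatives are.
    With s the sign, the coefficient of z^(N-1) is the following.

    - For exp (- s h) it is - s omega(N), by definition of h.
    - For the infinite product it is - s times the sum of d Theta(d) over the
      divisors d of N.  This sum is omega(N) ([omega_sum_Theta]): a word is in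
      a unique way a power of a word that has no proper rotation fixing it, and
      the class under rotation of such a word of length d has d elements.  Only
      finitely many factors matter for a given coefficient, hence convergence.
    - For det (1 - z T) it is - tr T^N, by Jacobi's formula for the derivative
      of a determinant ([log_deriv_det_1subXmx]).  The trace tr T^N counts the
      cycles of length N, and inclusion-exclusion over the set A of deleted
      edges keeps those that miss no edge: the alternating sum over A of the
      traces for G - A is omega(N) ([omega_sum_trace]).

    The last expression is the expansion of the exponential: modulo a power of
    z, exp (- s h) is the finite product of the exponentials of the monomials
    of - s h, and distributing that product gives the sum over the exponents
    a_1, ..., a_i ([fps_exp_coef]). *)

(** * Derivations and determinants *)

Section Derivation.
Variables (R : comNzRingType) (D : {additive R -> R}).
Hypothesis D_leibniz : forall x y, D (x * y) = D x * y + x * D y.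

Lemma derivation_prod (I : eqType) (r : seq I) (F : I -> R) : uniq r ->
  D (\prod_(i <- r) F i) =
  \sum_(i <- r) D (F i) * \prod_(j <- r | j != i) F j.
Proof.
elim: r => [|a r IHr] /=.
  have D1 : D 1 = 0.
    by apply: (addrI (D 1)); rewrite addr0 -{3}[1]mulr1 D_leibniz mulr1 mul1r.
  by rewrite !big_nil D1.
case/andP=> a_r uniq_r; rewrite !big_cons D_leibniz eqxx /= IHr //.
congr (_ * _ + _).
  rewrite [RHS]big_seq_cond big_seq; apply: eq_bigl => j.
  by case: (boolP (j \in r)) => //= rj; rewrite eq_sym (memPnC a_r).
rewrite mulr_sumr [LHS]big_seq [RHS]big_seq; apply: eq_bigr => i ri.
rewrite big_cons; case: eqP ri a_r => [-> -> //|_ _ _ /=]; ring.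
Qed.

(** Jacobi's formula.  By the Leibniz rule, D (det A) is the sum over i of the
    determinant of A with D applied to its row i; expanding along that row
    leaves the cofactors of A. *)
Lemma derivation_det n (A : 'M[R]_n) :
  D (\det A) = \tr (map_mx D A *m \adj A).
Proof.
rewrite /determinant raddf_sum /=.
pose B i := \matrix_(k, j) if k == i then D (A k j) else A k j.
transitivity (\sum_i \det (B i)).
  rewrite exchange_big; apply: eq_bigr => s _.
  rewrite raddfMsign derivation_prod ?index_enum_uniq // mulr_sumr.
  apply: eq_bigr => i _; congr (_ * _).
  rewrite [RHS](bigD1 i) //= mxE eqxx; congr (_ * _).
  by apply: eq_bigr => j /negPf ji; rewrite mxE ji.
apply: eq_bigr => i _; rewrite (expand_det_row _ i) mxE.
apply: eq_bigr => j _; rewrite !mxE eqxx; congr (_ * _).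
rewrite /cofactor; congr (_ * \det _).
by apply/matrixP=> k l; rewrite !mxE eq_sym (negPf (neq_lift _ _)).
Qed.

End Derivation.

(** * Logarithmic derivatives of power series *)

Section FormalDerivative.
Variable R : numFieldType.
Implicit Types (f g F G L : {fps R}) (n m : nat).

Definition fps_deriv f : {fps R} := FPS (fun n => n.+1%:R * f n.+1).

Fact fps_deriv_is_zmod_morphism : zmod_morphism fps_deriv.
Proof.
by move=> f g; apply: fpsP => n; rewrite fpsDE fpsNE /= mulrBr.
Qed.
HB.instance Definition _ := GRing.isZmodMorphism.Build {fps R} {fps R}
  fps_deriv fps_deriv_is_zmod_morphism.

Lemma fps_derivM f g :
  fps_deriv (f * g) = fps_deriv f * g + f * fps_deriv g.
Proof.
apply: fpsP => n; rewrite fpsDE [LHS]/= !fpsME mulr_sumr.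
have natE (i : 'I_n.+2) : n.+1%:R * (f i * g (n.+1 - i)%N) =
    i%:R * f i * g (n.+1 - i)%N + f i * ((n.+1 - i)%:R * g (n.+1 - i)%N).
  by rewrite natrB -1?ltnS //; ring.
rewrite (eq_bigr _ (fun i _ => natE i)) big_split /=; congr (_ + _).
  rewrite big_ord_recl /= !mul0r add0r; apply: eq_bigr => i _.
  by rewrite /= /bump /= add1n subSS.
rewrite big_ord_recr /= subnn mul0r mulr0 addr0; apply: eq_bigr => i _.
by rewrite subSn // -ltnS.
Qed.

Lemma fps_derivX f k : fps_deriv (f ^+ k.+1) = fps_deriv f * f ^+ k *+ k.+1.
Proof.
elim: k => [|k IHk]; first by rewrite expr1 expr0 mulr1.
rewrite exprS fps_derivM IHk [in RHS]mulrS; congr (_ + _).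
by rewrite mulrnAr exprS; congr (_ *+ _); ring.
Qed.

Lemma fpsMnE f k n : (f *+ k) n = f n *+ k.
Proof. by elim: k => // k IHk; rewrite !mulrS fpsDE IHk. Qed.

Lemma fpsMzE f (z : int) n : (f *~ z) n = f n *~ z.
Proof. by case: z => k; rewrite ?NegzE ?mulrNz ?fpsNE fpsMnE. Qed.

Definition fps_eqmod n f g := forall m, (m < n)%N -> f m = g m.

Lemma fps_eqmodP f g : (forall n, fps_eqmod n f g) -> f = g.
Proof. by move=> fg; apply: fpsP => n; exact: (fg n.+1). Qed.

Lemma fps_eqmodM n f f' g g' :
  fps_eqmod n f f' -> fps_eqmod n g g' -> fps_eqmod n (f * g) (f' * g').
Proof.
move=> ff' gg' m lt_mn; rewrite !fpsME; apply: eq_bigr => i _.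
have le_im : (i <= m)%N by rewrite -ltnS.
by rewrite ff' ?gg' // (leq_ltn_trans _ lt_mn) ?leq_subr.
Qed.

Lemma fps_eqmod_prod n (I : Type) (r : seq I) (P : pred I)
    (F F' : I -> {fps R}) :
  (forall i, P i -> fps_eqmod n (F i) (F' i)) ->
  fps_eqmod n (\prod_(i <- r | P i) F i) (\prod_(i <- r | P i) F' i).
Proof.
by move=> FF'; apply: (big_ind2 (fps_eqmod n)) => // *; apply: fps_eqmodM.
Qed.

(** L = F' / F, written without division; the condition on F 0 is the
    normalization that makes L determine F. *)
Definition log_deriv F L : Prop := F 0%N = 1 /\ fps_deriv F = F * L.

(** The equation defining [log_deriv F L] gives (m + 1) times the coefficient m + 1 of F in
    terms of the coefficients of F and L of degree at most m, and m + 1 is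
    invertible.  The truncated form is what an infinite product calls for. *)
Lemma log_deriv_eqmod n F F' L L' : log_deriv F L -> log_deriv F' L' ->
  fps_eqmod n L L' -> fps_eqmod n.+1 F F'.
Proof.
move=> [F0 DF] [F'0 DF'] LL' m; elim/ltn_ind: m => -[|m] IHm lt_mn.
  by rewrite F0 F'0.
have m1_neq0 : m.+1%:R != 0 :> R by rewrite pnatr_eq0.
apply: (mulfI m1_neq0); rewrite -[LHS]/(fps_deriv F m) -[RHS]/(fps_deriv F' m).
rewrite DF DF' !fpsME; apply: eq_bigr => i _.
rewrite IHm ?ltn_ord // ?(ltn_trans _ lt_mn) // LL' //.
exact: leq_ltn_trans (leq_subr _ _) (lt_mn : (m < n)%N).
Qed.

Lemma log_deriv_inj F F' L : log_deriv F L -> log_deriv F' L -> F = F'.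
Proof.
move=> FL F'L; apply: fps_eqmodP => n m lt_mn.
by apply: (log_deriv_eqmod FL F'L (n := n)) => //; apply: leqW.
Qed.

Lemma log_deriv1 : log_deriv 1 0.
Proof.
by split; [rewrite fps1E | apply: fpsP => n; rewrite mulr0 /= mulr0].
Qed.

Lemma fpsM_coef0 f g : (f * g) 0%N = f 0%N * g 0%N.
Proof. by rewrite fpsME big_ord1. Qed.

Lemma log_derivM F F' L L' : log_deriv F L -> log_deriv F' L' ->
  log_deriv (F * F') (L + L').
Proof.
move=> [F0 DF] [F'0 DF']; split; first by rewrite fpsM_coef0 F0 F'0 mulr1.
by rewrite fps_derivM DF DF'; ring.
Qed.

Lemma log_deriv_prod (I : Type) (r : seq I) (P : pred I) (F L : I -> {fps R}) :
  (forall i, P i -> log_deriv (F i) (L i)) ->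
  log_deriv (\prod_(i <- r | P i) F i) (\sum_(i <- r | P i) L i).
Proof.
move=> FL; apply: (big_ind2 log_deriv) => //; first exact: log_deriv1.
by move=> *; apply: log_derivM.
Qed.

Lemma log_derivV F L : log_deriv F L -> log_deriv F^-1 (- L).
Proof.
move=> [F0 DF]; have uF : F \is a GRing.unit.
  by rewrite unfold_in /= /fps_unit F0 oner_neq0.
have FV := divrr uF.
split; first by move: (congr1 (fun f => f 0%N) FV); rewrite fpsM_coef0 F0 mul1r.
apply: (mulrI uF); have := congr1 fps_deriv FV.
rewrite fps_derivM DF (log_deriv1).2 mulr0 => /eqP.
rewrite addrC addr_eq0 => /eqP->.
by ring.
Qed.

Lemma log_deriv_exprz F L (k : int) :
  log_deriv F L -> log_deriv (F ^ k) (L *~ k).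
Proof.
move=> FL; have FLn n : log_deriv (F ^+ n) (L *+ n).
  elim: n => [|n IHn]; first exact: log_deriv1.
  by rewrite exprS mulrS; apply: log_derivM.
case: k => n; first exact: FLn.
by rewrite NegzE mulrNz; apply: log_derivV; apply: FLn.
Qed.

(** Term by term, f^k / k! has derivative f' f^(k-1) / (k-1)!, so differentiation
    shifts the exponential series by one and multiplies it by f'. *)
Lemma log_deriv_exp f : f 0%N = 0 -> log_deriv (fps_exp f) (fps_deriv f).
Proof.
move=> f0; split; first by rewrite /= big_ord1 fact0 divr1.
have expE n m : (m <= n)%N ->
    fps_exp f m = \sum_(k < n.+1) (f ^+ k) m / k`!%:R.
  move=> le_mn; rewrite /= -(subnKC le_mn) -addSn big_split_ord /=.
  rewrite [X in _ + X]big1 ?addr0 // => k _.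
  by rewrite fps_expn_order ?mul0r // ltn_addr.
apply: fpsP => n.
transitivity (n.+1%:R * \sum_(k < n.+2) (f ^+ k) n.+1 / k`!%:R) => //.
rewrite big_ord_recl [X in X + _]mul0r add0r mulr_sumr fpsME.
transitivity (\sum_(i < n.+1) \sum_(k < n.+1)
    (f ^+ k) i / k`!%:R * fps_deriv f (n - i)%N); last first.
  by apply: eq_bigr => i _; rewrite (@expE n) -1?ltnS // mulr_suml.
rewrite exchange_big; apply: eq_bigr => k _ /=; rewrite /bump /= add1n.
have -> : n.+1%:R * ((f ^+ k.+1) n.+1 / (k.+1)`!%:R) =
    fps_deriv (f ^+ k.+1) n / (k.+1)`!%:R by rewrite /= mulrA.
rewrite fps_derivX fpsMnE -[_ *+ k.+1]mulr_natl factS natrM invfM.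
rewrite mulrACA mulfV ?pnatr_eq0 // mul1r [_ * f ^+ k]mulrC fpsME mulr_suml.
by apply: eq_bigr => i _; rewrite mulrAC.
Qed.

Fact fpsC_is_zmod_morphism : zmod_morphism (@fpsC R).
Proof. by move=> a b; apply: fpsP => -[|n]; rewrite fpsDE fpsNE //= subr0. Qed.
Fact fpsC_is_monoid_morphism : monoid_morphism (@fpsC R).
Proof.
split=> [|a b]; apply: fpsP => -[|n] //; rewrite fpsCM //=.
by rewrite mulr0.
Qed.
HB.instance Definition _ := GRing.isZmodMorphism.Build R {fps R}
  (@fpsC R) fpsC_is_zmod_morphism.
HB.instance Definition _ := GRing.isMonoidMorphism.Build R {fps R}
  (@fpsC R) fpsC_is_monoid_morphism.

(** Evaluation at z = 0, as a ring morphism that commutes with determinants. *)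
Definition fps_coef0 f : R := f 0%N.
Fact fps_coef0_is_zmod_morphism : zmod_morphism fps_coef0.
Proof. by move=> f g; rewrite /fps_coef0 fpsDE fpsNE. Qed.
Fact fps_coef0_is_monoid_morphism : monoid_morphism fps_coef0.
Proof. by split=> [|f g]; rewrite /fps_coef0 ?fpsM_coef0 ?fps1E. Qed.
HB.instance Definition _ := GRing.isZmodMorphism.Build {fps R} R
  fps_coef0 fps_coef0_is_zmod_morphism.
HB.instance Definition _ := GRing.isMonoidMorphism.Build {fps R} R
  fps_coef0 fps_coef0_is_monoid_morphism.

Lemma fpsXM f n : (fpsX * f) n = if n is m.+1 then f m else 0.
Proof.
rewrite fpsME big_ord_recl /= mul0r add0r.
case: n => [|n]; first by rewrite big_ord0.
rewrite big_ord_recl /= mul1r subn1 big1 ?addr0 // => i _.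
by rewrite /= mul0r.
Qed.

Lemma fpsXnM k f n : (fpsX ^+ k * f) n = if (n < k)%N then 0 else f (n - k)%N.
Proof.
elim: k n => [|k IHk] n; first by rewrite expr0 mul1r ltn0 subn0.
by rewrite exprS -mulrA fpsXM; case: n => [|n] //; rewrite IHk.
Qed.

Lemma fpsXnE k n : (fpsX ^+ k : {fps R}) n = (n == k)%:R.
Proof.
rewrite -[_ ^+ k]mulr1 fpsXnM fps1E subn_eq0.
by case: ltngtP.
Qed.

(** - N z^(N-1) / (1 - z^N) expanded as a geometric series. *)
Lemma log_deriv_1subXn N : (0 < N)%N ->
  log_deriv (1 - fpsX ^+ N)
    (FPS (fun n => - (if (N %| n.+1)%N then N%:R else 0))).
Proof.
move=> N_gt0; split.
  by rewrite fpsDE fpsNE fpsXnE fps1E (ltn_eqF N_gt0) subr0.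
apply: fpsP => n; transitivity (n.+1%:R * - (n.+1 == N)%:R : R).
  by congr (_ * _); rewrite fpsDE fpsNE fpsXnE fps1E sub0r.
rewrite mulrBl mul1r fpsDE fpsNE fpsXnM /=.
case: ltnP => [lt_nN|le_Nn].
  rewrite subr0 mulrN; congr (- _).
  case: eqP => [<-|neq]; first by rewrite dvdnn mulr1.
  rewrite mulr0 ifN //; apply/negP => /dvdn_leq le; apply: neq.
  by apply/eqP; rewrite eqn_leq lt_nN le.
have N_dvd : (N %| n.+1)%N = (N %| (n - N).+1)%N.
  by rewrite -{1}(subnK le_Nn) -addSn dvdn_addl.
by rewrite N_dvd opprK addNr gtn_eqF ?ltnS // oppr0 mulr0.
Qed.

(** The formal version of det (1 - z T) = exp (- sum of tr T^N z^N / N).  The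
    matrix S with entries sum of (T^k)_ij z^k is the inverse of A = 1 - z T, so
    the adjugate of A is det A times S, and Jacobi's formula with A' = - T gives
    (det A)' = - det A tr (T S). *)
Lemma log_deriv_det_1subXmx n (T : 'M[R]_n) :
  log_deriv (\det (1%:M - fpsX *: map_mx (@fpsC R) T))
    (FPS (fun k => - \tr (T ^+ k.+1))).
Proof.
set A := 1%:M - _.
have AE i j k : A i j k = (k == 0)%N%:R *+ (i == j) - (k == 1)%N%:R * T i j.
  rewrite !mxE fpsDE fpsNE fpsMnE fps1E fpsXM; congr (_ - _).
  by case: k => [|[|k]] /=; rewrite ?mul0r ?mul1r.
split.
  rewrite -[LHS]/(fps_coef0 _) -det_map_mx [X in \det X](_ : _ = 1%:M) ?det1 //.
  apply/matrixP=> i j; rewrite [LHS]mxE [RHS]mxE -[LHS]/(A i j 0%N).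
  by rewrite AE mul0r subr0.
pose S := \matrix_(i, j) FPS (fun k => (T ^+ k) i j).
have TS : map_mx (@fpsC R) T *m S =
    \matrix_(i, j) FPS (fun k => (T ^+ k.+1) i j).
  apply/matrixP=> i j; rewrite !mxE; apply: fpsP => k; rewrite fps_sumE.
  rewrite -[RHS]/((T ^+ k.+1) i j) exprS -mulmxE [RHS]mxE.
  apply: eq_bigr => l _.
  by rewrite !mxE fpsCM.
have AS : A *m S = 1%:M.
  rewrite mulmxBl mul1mx -scalemxAl TS; apply/matrixP=> i j; apply: fpsP => k.
  rewrite !mxE fpsDE fpsNE fpsMnE fps1E fpsXM.
  by case: k => [|k] /=; rewrite ?expr0 ?mxE ?subr0 // subrr mul0rn.
have adjA : \adj A = \det A *: S.
  by rewrite -[LHS]mulmx1 -AS mulmxA mul_adj_mx mul_scalar_mx.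
have DA : map_mx (@fps_deriv) A = - map_mx (@fpsC R) T.
  apply/matrixP=> i j; apply: fpsP => k.
  transitivity (k.+1%:R * A i j k.+1); first by rewrite mxE.
  rewrite AE !mxE fpsNE; case: k => [|k] /=;
    by rewrite mul0rn sub0r ?mulr1 ?mul1r ?mul0r ?oppr0 ?mulr0.
rewrite (derivation_det fps_derivM) DA adjA -scalemxAr mulNmx TS scalerN raddfN.
rewrite /= mxtraceZ -mulrN; congr (_ * _); apply: fpsP => k.
by rewrite fpsNE fps_sumE; congr (- _); apply: eq_bigr => i _; rewrite mxE.
Qed.

(** Modulo z^(i+1), f is the sum of its monomials f_k z^k with 0 < k <= i, so
    exp f is the product of the exp (f_k z^k); each of these can be truncated to
    the terms (f_k z^k)^a / a! with a <= i before the product is distributed. *)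
Lemma fps_exp_coef f i : f 0%N = 0 ->
  fps_exp f i =
  \sum_(a : {ffun 'I_i -> 'I_i.+1} | (\sum_(k < i) k.+1 * a k == i)%N)
    \prod_(k < i) (f k.+1 ^+ a k / (a k)`!%:R).
Proof.
move=> f0; pose mono k := fpsC (f k.+1) * fpsX ^+ k.+1.
have monoE k n : mono k n = f k.+1 * (n == k.+1)%:R.
  by rewrite /mono fpsCM fpsXnE.
have mono0 k : mono k 0%N = 0 by rewrite monoE mulr0.
(* The two sides have logarithmic derivatives that agree below degree i. *)
have expf : fps_eqmod i.+1 (fps_exp f) (\prod_(k < i) fps_exp (mono k)).
  have Lprod : log_deriv (\prod_(k < i) fps_exp (mono k))
      (\sum_(k < i) fps_deriv (mono k)).
    by apply: log_deriv_prod => k _; apply/log_deriv_exp/mono0.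
  apply: log_deriv_eqmod (log_deriv_exp f0) Lprod _ => m lt_mi.
  have DE k : fps_deriv (mono k) m = m.+1%:R * (f k.+1 * (m == k)%:R).
    by congr (_ * _); rewrite monoE eqSS.
  rewrite fps_sumE (bigD1 (Ordinal lt_mi)) // DE eqxx mulr1.
  rewrite big1 => [|k neq_km]; first by rewrite /= addr0.
  rewrite DE (_ : (_ == _) = false) ?mulr0 //.
  by apply: contraNF neq_km => /eqP mk; apply/eqP/val_inj.
pose trunc k :=
  \sum_(a < i.+1) fpsC (f k.+1 ^+ a / a`!%:R) * fpsX ^+ (k.+1 * a).
have monoX k a n : (mono k ^+ a) n / a`!%:R =
    f k.+1 ^+ a / a`!%:R * (n == k.+1 * a)%N%:R.
  by rewrite /mono exprMn -rmorphXn -exprM fpsCM fpsXnE mulrAC.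
have exp_mono k : fps_eqmod i.+1 (fps_exp (mono k)) (trunc k).
  move=> n; rewrite ltnS => le_ni.
  transitivity (\sum_(a < i.+1) f k.+1 ^+ a / a`!%:R * (n == k.+1 * a)%N%:R).
    rewrite -(subnKC le_ni) -addSn big_split_ord /= [X in _ + X]big1 ?addr0.
      by apply: eq_bigr => a _; rewrite monoX.
    move=> a _; rewrite ltn_eqF ?mulr0 //.
    by rewrite mulSn -addnA addSn ltnS leq_addr.
  by rewrite fps_sumE; apply: eq_bigr => a _; rewrite fpsCM fpsXnE.
rewrite (expf _ (ltnSn i)).
rewrite (fps_eqmod_prod _ (fun k _ => exp_mono (nat_of_ord k)) (ltnSn i)).
rewrite bigA_distr_bigA /= fps_sumE [RHS]big_mkcond; apply: eq_bigr => a _.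
rewrite big_split -rmorph_prod prodrXr fpsCM fpsXnE eq_sym.
by case: eqP; rewrite ?mulr1 ?mulr0.
Qed.

End FormalDerivative.

(** * Powers of words and rotations *)

Section Powers.
Variable T : eqType.
Implicit Types (p q s w : seq T).

Definition seq_pow w k := flatten (nseq k w).

Lemma size_seq_pow w k : size (seq_pow w k) = (k * size w)%N.
Proof. by rewrite size_flatten /shape map_nseq sumn_nseq mulnC. Qed.

Lemma seq_powS w k : seq_pow w k.+1 = w ++ seq_pow w k.
Proof. by []. Qed.

Lemma seq_powD w i j : seq_pow w (i + j) = seq_pow w i ++ seq_pow w j.
Proof. by rewrite /seq_pow nseqD flatten_cat. Qed.

Lemma seq_powM w i j : seq_pow w (i * j) = seq_pow (seq_pow w j) i.
Proof. by elim: i => // i IHi; rewrite mulSn seq_powD IHi. Qed.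

Lemma mem_seq_pow w k x : (0 < k)%N -> (x \in seq_pow w k) = (x \in w).
Proof.
case: k => // k _; elim: k => [|k IHk]; first by rewrite /seq_pow /= cats0.
by rewrite seq_powS mem_cat IHk orbb.
Qed.

Lemma rot_seq_pow w k : rot (size w) (seq_pow w k) = seq_pow w k.
Proof.
case: k => // k; rewrite [in LHS]seq_powS rot_size_cat.
by rewrite -addn1 seq_powD /seq_pow /= cats0.
Qed.

Lemma cycle_seq_pow (e : rel T) w k :
  (0 < k)%N -> cycle e (seq_pow w k) = cycle e w.
Proof.
case: k => // k _; case: w => [|x w].
  by rewrite /seq_pow; elim: k => //= k ->.
set s := x :: w; have last_s y : last y s = last x s by [].
rewrite !(cycle_path x).
have -> : last x (seq_pow s k.+1) = last x s.
  by rewrite -addn1 seq_powD last_cat /seq_pow /= cats0.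
elim: k => [|k IHk]; first by rewrite /seq_pow /= cats0.
by rewrite seq_powS cat_path last_s IHk andbb.
Qed.

(** The commutation relation forces w to be a prefix of s, and the rest of s
    again commutes with w. *)
Lemma comm_seq_pow w s k :
  size s = (k * size w)%N -> w ++ s = s ++ w -> s = seq_pow w k.
Proof.
elim: k s => [|k IHk] s size_s comm_s; first exact: size0nil.
have le_ws : (size w <= size s)%N by rewrite size_s leq_addr.
have s_w : take (size w) s = w.
  by rewrite -(takel_cat w le_ws) -comm_s take_size_cat.
move: comm_s size_s; rewrite -{1 2 3}(cat_take_drop (size w) s) s_w.
rewrite -catA => /eqP; rewrite eqseq_cat // eqxx => /eqP comm_s.
rewrite size_cat mulSn => /addnI size_s.
by rewrite -[in LHS](cat_take_drop (size w) s) s_w seq_powS -(IHk _ size_s).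
Qed.

Lemma take_seq_pow w i j : (i <= j)%N ->
  take (i * size w) (seq_pow w j) = seq_pow w i.
Proof.
by move=> le_ij; rewrite -(subnKC le_ij) seq_powD take_size_cat ?size_seq_pow.
Qed.

(** A word fixed by the rotation by d commutes with its prefix of length d. *)
Lemma rot_fix_seq_pow d s : (d %| size s)%N -> rot d s = s ->
  s = seq_pow (take d s) (size s %/ d).
Proof.
case: d => [|d]; first by rewrite dvd0n => /eqP/size0nil->.
move=> dvd_ds rot_s; have [s0|s_gt0] := posnP (size s).
  by rewrite (size0nil s0).
have le_ds := dvdn_leq s_gt0 dvd_ds; set w := take _ s.
have size_w : size w = d.+1 by rewrite size_takel.
have s_w : s = w ++ drop d.+1 s by rewrite cat_take_drop.
have comm_s : w ++ s = s ++ w.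
  have s_rot : s = drop d.+1 s ++ w by rewrite -[LHS]rot_s.
  by rewrite [X in w ++ X = _]s_rot catA -s_w.
apply: comm_seq_pow => //.
by rewrite size_w divnK.
Qed.
End Powers.

Section Necklaces.
Variables (T : finType) (N : nat).
Hypothesis N_gt0 : (0 < N)%N.
Implicit Types x y : N.-tuple T.

(** Rotation by one step, as a self-map of the finite type of N-tuples, so that
    the theory of orbits applies to it. *)
Definition rot1_tuple x : N.-tuple T := [tuple of rot 1 x].

Lemma rot1_tuple_inj : injective rot1_tuple.
Proof. by move=> x y /(congr1 val) /= /rot_inj/val_inj. Qed.

Lemma iter_rot1_tuple x i : (i <= N)%N ->
  iter i rot1_tuple x = rot i x :> seq T.
Proof.
elim: i => [|i IHi] le_iN; first by rewrite rot0.
by rewrite rotS ?size_tuple //= -IHi // ltnW.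
Qed.

(** The least positive rotation that fixes x, i.e. its primitive period. *)
Definition rot_order x := fingraph.order rot1_tuple x.

(** The remainder of i modulo the order is also a rotation fixing x, and it is
    smaller than the order, hence zero. *)
Lemma rot_order_dvd x i : (i <= N)%N -> rot i x = x -> (rot_order x %| i)%N.
Proof.
move=> le_iN rot_x; have iter_x : iter i rot1_tuple x = x.
  by apply: val_inj; rewrite /= iter_rot1_tuple.
have o_gt0 : (0 < rot_order x)%N by apply: fingraph.order_gt0.
have iter_o j : iter (j * rot_order x) rot1_tuple x = x.
  elim: j => // j IHj; rewrite mulSn iterD IHj fingraph.iter_order //.
  exact: rot1_tuple_inj.
have /(fingraph.findex_iter (f := rot1_tuple)) := ltn_pmod i o_gt0.
move: iter_x; rewrite {1}(divn_eq i (rot_order x)) addnC iterD iter_o => ->.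
by rewrite fingraph.findex0 => /esym/eqP.
Qed.

Lemma rot_order_dvd_size x : (rot_order x %| N)%N.
Proof. by apply: rot_order_dvd => //; rewrite rot_oversize ?size_tuple. Qed.

Lemma rot_order_le x : (rot_order x <= N)%N.
Proof. exact: dvdn_leq (rot_order_dvd_size x). Qed.

Lemma rot_order_id x : rot (rot_order x) x = x.
Proof.
rewrite -iter_rot1_tuple ?rot_order_le // fingraph.iter_order //.
exact: rot1_tuple_inj.
Qed.

Lemma tuple_seq_pow x :
  x = seq_pow (take (rot_order x) x) (N %/ rot_order x) :> seq T.
Proof.
have /rot_fix_seq_pow/(_ (rot_order_id x)) : (rot_order x %| size x)%N.
  by rewrite size_tuple rot_order_dvd_size.
by rewrite size_tuple.
Qed.

Lemma fconnect_rotP x y :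
  reflect (exists i, y = rot i x :> seq T) (fconnect rot1_tuple x y).
Proof.
apply: (iffP idP) => [xy | [i yE]].
  exists (fingraph.findex rot1_tuple x y).
  rewrite -iter_rot1_tuple ?fingraph.iter_findex //.
  by rewrite ltnW // (leq_trans (fingraph.findex_max xy)) ?rot_order_le.
have [le_iN|lt_Ni] := leqP i N.
  rewrite (_ : y = iter i rot1_tuple x) ?fconnect_iter //.
  by apply: val_inj; rewrite /= yE iter_rot1_tuple.
rewrite (_ : y = x) ?connect0 //; apply: val_inj.
by rewrite /= yE rot_oversize ?size_tuple // ltnW.
Qed.

End Necklaces.

(** * Counting words and necklaces *)

Section CountNecklaces.
Variables (T : finType) (P : pred (seq T)).
Hypothesis P_pow : forall w k, (0 < k)%N -> P (seq_pow w k) = P w.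
Hypothesis P_rot : forall s i, P (rot i s) = P s.

(** The words with N distinct rotations, that is, the non periodic ones. *)
Definition primitive_words N : {set N.-tuple T} :=
  [set x : N.-tuple T | P x && (rot_order x == N)].

(** The bijection is q |-> q^(N/d), with inverse the prefix of length d.  That
    both maps preserve the order is the uniqueness of the primitive root: a
    rotation that fixes q also fixes every power of q, and a rotation by a
    divisor of the length of q that fixes a power of q fixes q. *)
Lemma card_rot_order N d : (0 < N)%N -> (d %| N)%N ->
  #|[set x : N.-tuple T | P x && (rot_order x == d)]| = #|primitive_words d|.
Proof.
move=> N_gt0 dvd_dN; have d_gt0 := dvdn_gt0 N_gt0 dvd_dN.
have le_dN := dvdn_leq N_gt0 dvd_dN.
have size_pow (q : d.-tuple T) : size (seq_pow q (N %/ d)) == N.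
  by rewrite size_seq_pow size_tuple divnK.
have quo_gt0 : (0 < N %/ d)%N by rewrite divn_gt0.
pose F q := Tuple (size_pow q).
have take_F q : take d (F q) = q.
  have := @take_seq_pow _ q 1 (N %/ d) quo_gt0.
  by rewrite mul1n size_tuple /seq_pow /= cats0.
have F_inj : injective F.
  by move=> p q pq; apply: val_inj; rewrite /= -take_F pq take_F.
rewrite -(card_imset _ F_inj); apply: eq_card => x.
rewrite inE; apply/andP/imsetP=> [[Px /eqP ox] | [q + ->]].
  have size_q : size (take d x) == d.
    by rewrite size_takel ?size_tuple.
  have xE : x = seq_pow (take d x) (N %/ d) :> seq T.
    by rewrite -ox; apply: tuple_seq_pow.
  exists (Tuple size_q); last by apply: val_inj.
  rewrite inE /= -(P_pow _ quo_gt0) -xE Px eqn_dvd /=.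
  rewrite rot_order_dvd_size //= -{1}ox.
  set q := Tuple size_q; set o := rot_order q.
  have o_dvd : (o %| d)%N by apply: rot_order_dvd_size.
  have o_le : (o <= d)%N by apply: rot_order_le.
  apply: rot_order_dvd => //; first exact: leq_trans le_dN.
  have size_o : size (take o q) = o by rewrite size_takel ?size_tuple.
  have qE : take d x = seq_pow (take o q) (d %/ o).
    exact (tuple_seq_pow d_gt0 q).
  by rewrite xE qE -seq_powM -{1}size_o rot_seq_pow.
rewrite inE => /andP[Pq /eqP oq]; split; first by rewrite P_pow.
set o := rot_order (F q).
have o_dvd : (o %| d)%N.
  apply: rot_order_dvd => //;   by rewrite -{1}(size_tuple q) rot_seq_pow.
have o_le : (o <= d)%N by apply: dvdn_leq.
have size_o : size (take o (F q)) = o.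
  by rewrite size_takel ?size_tuple ?rot_order_le.
have qE : q = seq_pow (take o (F q)) (d %/ o) :> seq T.
  have FE := tuple_seq_pow N_gt0 (F q).
  have le_quo : (d %/ o <= N %/ o)%N by rewrite leq_div2r.
  have := take_seq_pow (take o (F q)) le_quo.
  by rewrite -FE size_o divnK // take_F.
rewrite eqn_dvd o_dvd -[X in (X %| _)%N]oq /=; apply: rot_order_dvd => //.
by rewrite qE -{1}size_o rot_seq_pow.
Qed.

(** Classifying the words of length N by their rotation order. *)
Lemma card_necklaces N : (0 < N)%N ->
  #|[set x : N.-tuple T | P x]| =
  (\sum_(1 <= d < N.+1 | d %| N) #|primitive_words d|)%N.
Proof.
move=> N_gt0.
transitivity (\sum_(x : N.-tuple T | P x)
    \sum_(1 <= d < N.+1 | (d %| N)%N) (rot_order x == d))%N.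
  rewrite -sum1_card; apply: eq_big => [x|x _]; first by rewrite inE.
  have o_in : rot_order x \in index_iota 1 N.+1.
    by rewrite mem_index_iota ltnS rot_order_le // fingraph.order_gt0.
  rewrite big_mkcond (bigD1_seq _ o_in (iota_uniq _ _)) /=.
  rewrite rot_order_dvd_size // eqxx big1 // => d.
  by rewrite eq_sym => /negPf ->; rewrite if_same.
rewrite exchange_big; apply: eq_bigr => d dvd_dN.
rewrite -(card_rot_order N_gt0 dvd_dN) -sum1_card big_mkcond [RHS]big_mkcond /=.
by apply: eq_bigr => x _; rewrite inE; case: (P x).
Qed.

(** Each rotation class of primitive words is an orbit with N elements. *)
Lemma card_primitive_words N : (0 < N)%N ->
  #|primitive_words N| =
  (N * #|equivalence_partition (fun x y => `[< exists i, tval y = rot i x >])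
           (primitive_words N)|)%N.
Proof.
move=> N_gt0; set e := (fun x y : N.-tuple T => _).
have eE x y : e x y = fconnect (@rot1_tuple T N) x y.
  by apply/asboolP/fconnect_rotP.
have rot_sym := fconnect_sym (@rot1_tuple_inj T N).
have e_equiv : {in primitive_words N & &, equivalence_rel e}.
  move=> x y z _ _ _; rewrite !eE; split; first exact: connect0.
  by move=> xy; rewrite (same_connect rot_sym xy).
rewrite mulnC; apply: card_uniform_partition (equivalence_partitionP e_equiv).
move=> A /imsetP[x xP ->]; have := xP; rewrite inE => /andP[Px /eqP ox].
rewrite -[RHS]ox; apply: eq_card => y; rewrite inE eE andb_idl // => xy.
rewrite !inE; have /fconnect_rotP[//|i ->] := xy.
rewrite P_rot Px /=; apply/eqP; rewrite -[RHS]ox; apply: eq_card => z.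
exact: esym (same_connect rot_sym xy z).
Qed.
End CountNecklaces.

(** * Traces of adjacency matrices *)

Section ClosedWalks.
Variables (R : nzRingType) (T : finType) (e : rel T).

Let B : 'M[R]_#|T| := \matrix_(i, j) (e (enum_val i) (enum_val j))%:R.

Lemma big_tuple_cons N (F : N.+1.-tuple T -> R) :
  \sum_(s : N.+1.-tuple T) F s =
  \sum_(x : T) \sum_(s : N.-tuple T) F (cons_tuple x s).
Proof.
rewrite pair_bigA /=.
rewrite (reindex (fun u : T * N.-tuple T => cons_tuple u.1 u.2)) //=.
exists (fun s : N.+1.-tuple T => (thead s, behead_tuple s)) => [[x s] _|s _].
  by congr (_, _); apply: val_inj.
by rewrite [RHS]tuple_eta; apply: val_inj.
Qed.

Lemma sum_enum_val (F : T -> R) :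
  \sum_(x : T) F x = \sum_(i < #|T|) F (enum_val i).
Proof. by rewrite -[RHS](big_enum_val F). Qed.

Lemma adjacency_expE N i j :
  (B ^+ N) i j = \sum_(s : N.-tuple T)
    (path e (enum_val i) s && (last (enum_val i) s == enum_val j))%:R.
Proof.
elim: N i j => [|N IHN] i j.
  rewrite expr0 mxE (big_pred1 [tuple]) => [|s]; last first.
    by apply/esym/eqP/val_inj; case: s => -[].
  by rewrite /= (inj_eq enum_val_inj).
rewrite exprS -mulmxE mxE big_tuple_cons (sum_enum_val (fun x => _)) /=.
apply: eq_bigr => k _; rewrite mxE IHN mulr_sumr; apply: eq_bigr => s _.
by rewrite -andbA; case: e; rewrite ?mul1r ?mul0r.
Qed.

(** A nonempty word s is an e-cycle exactly when it is an e-path issued from its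
    own last letter; hence only the diagonal entry at that letter counts s. *)
Lemma trace_adjacency_exp N : (0 < N)%N ->
  \tr (B ^+ N) = #|[set s : N.-tuple T | path.cycle e s]|%:R.
Proof.
move=> N_gt0; rewrite /mxtrace.
transitivity (\sum_(x : T) \sum_(s : N.-tuple T)
    (path e x s && (last x s == x))%:R : R).
  rewrite (sum_enum_val (fun x => _)) /=.
  by apply: eq_bigr => i _; rewrite adjacency_expE.
rewrite exchange_big -sum1_card natr_sum [RHS]big_mkcond; apply: eq_bigr => s _.
have [x last_s] : exists x, forall y, last y s = x.
  case: N s N_gt0 => // N s _; rewrite (tuple_eta s).
  by exists (last (thead s) (behead s)).
rewrite (bigD1 x) //= last_s eqxx andbT big1 ?addr0 => [|y /negPf neq_yx].
  by rewrite inE (cycle_path x) last_s; case: path.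
by rewrite last_s eq_sym neq_yx andbF.
Qed.

End ClosedWalks.

(** * Covering cycles of a graph *)

(* [path.arc] would otherwise hide the oriented edges. *)
Local Notation arc := Defs.arc.

Section CyclesOfGraph.
Variable G : multigraph.
Implicit Types (s : seq (arc G)) (N : nat).

Let covering_cycle s := is_cycle s && covering s.

Lemma is_cycle_seq_pow (w : seq (arc G)) k :
  (0 < k)%N -> is_cycle (seq_pow w k) = is_cycle w.
Proof.
move=> k_gt0; rewrite /is_cycle cycle_seq_pow // size_seq_pow muln_gt0 k_gt0.
by [].
Qed.

Lemma covering_cycle_seq_pow (w : seq (arc G)) k :
  (0 < k)%N -> covering_cycle (seq_pow w k) = covering_cycle w.
Proof.
move=> k_gt0; rewrite /covering_cycle is_cycle_seq_pow //; congr (_ && _).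
by apply: eq_forallb => e; rewrite !mem_seq_pow.
Qed.

Lemma covering_cycle_rot s i : covering_cycle (rot i s) = covering_cycle s.
Proof.
rewrite /covering_cycle /is_cycle size_rot rot_cycle; congr (_ && _).
by apply: eq_forallb => e; rewrite !mem_rot.
Qed.

(** A cycle q^r with r > 1 is fixed by the rotation by the length of q.
    Conversely a cycle of order d < N is the power N/d of its prefix of length
    d, and this prefix is itself a cycle. *)
Lemma nonperiodic_coveringE N : (0 < N)%N ->
  nonperiodic_covering_cycles G N = primitive_words covering_cycle N.
Proof.
move=> N_gt0; apply/setP=> x; rewrite !inE -/(covering_cycle x).
have [x_cov /=|//] := boolP (covering_cycle x).
have [o_N|o_neqN] := boolP (rot_order x == N); last first.
  apply/negbTE; rewrite negbK; apply/asboolP.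
  have xE := tuple_seq_pow N_gt0 x.
  exists (take (rot_order x) x), (N %/ rot_order x)%N; split=> //.
    have : covering_cycle (seq_pow (take (rot_order x) x) (N %/ rot_order x)).
      by rewrite -xE.
    rewrite covering_cycle_seq_pow => [/andP[]//|].
    by rewrite divn_gt0 ?fingraph.order_gt0 // rot_order_le.
  rewrite ltn_divRL ?rot_order_dvd_size // mul1n ltn_neqAle o_neqN.
  exact: rot_order_le.
apply/asboolP => -[q [r [q_cycle r_gt1 xE]]].
have q_gt0 : (0 < size q)%N by case/andP: q_cycle.
have NE : N = (r * size q)%N by rewrite -(size_tuple x) xE size_seq_pow.
have lt_qN : (size q < N)%N by rewrite NE ltn_Pmull.
have : (N %| size q)%N.
  rewrite -[X in (X %| _)%N](eqP o_N).
  apply: rot_order_dvd (ltnW lt_qN) _ => //.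
  by rewrite xE rot_seq_pow.
by move/(dvdn_leq q_gt0); rewrite leqNgt lt_qN.
Qed.

Lemma omega_sum_Theta N : (0 < N)%N ->
  omega G N = (\sum_(1 <= d < N.+1 | d %| N) d * Theta G d)%N.
Proof.
move=> N_gt0; rewrite /omega (card_necklaces covering_cycle_seq_pow) //.
rewrite big_nat_cond [RHS]big_nat_cond.
apply: eq_bigr => d /andP[/andP[d_gt0 _] _].
rewrite (card_primitive_words covering_cycle_rot) //.
by rewrite /Theta nonperiodic_coveringE.
Qed.

Definition avoids (A : {set edge G}) s := all (fun d => d.1 \notin A) s.

(** Inclusion of edge sets identifies the cycles of the graph with the edges in
    A deleted with the cycles of G that use no edge of A. *)
Lemma card_cycles_delete (A : {set edge G}) N :
  #|[set s : N.-tuple (arc (delete_edges A)) | path.cycle (@follows _) s]| =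
  #|[set s : N.-tuple (arc G) | path.cycle (@follows G) s && avoids A s]|.
Proof.
pose f (d : arc (delete_edges A)) : arc G := (val d.1, d.2).
have f_inj : injective f.
  by move=> [e b] [e' b'] [] /val_inj -> ->.
have f_follows d d' : follows (f d) (f d') = follows d d'.
  by rewrite /follows -[arc_inv (f d)]/(f (arc_inv d)) (inj_eq f_inj).
have F_inj : injective (map_tuple f : N.-tuple _ -> N.-tuple (arc G)).
  by move=> s s' /(congr1 val) /= /(inj_map f_inj)/val_inj.
rewrite -(card_imset _ F_inj); apply: eq_card => s; rewrite !inE.
have cycle_f (s' : seq (arc (delete_edges A))) :
    path.cycle (@follows G) (map f s') = path.cycle (@follows _) s'.
  by rewrite cycle_map; apply: eq_cycle.
apply/imsetP/andP=> [[s' + ->] | [cyc_s av_s]].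
  rewrite inE /= cycle_f => ->; split=> //.
  by apply/allP=> d /mapP[d' _ ->]; apply: (valP d'.1).
have [s' sE] : exists s' : seq (arc (delete_edges A)), tval s = map f s'.
  rewrite /avoids in av_s.
  elim: {cyc_s} (tval s) av_s => [|[e b] t IHt] /=; first by exists [::].
  case/andP=> eA /IHt[t' ->].
  by exists ((exist _ e eA, b) :: t').
have size_s' : size s' == N by rewrite -(size_map f) -sE size_tuple.
exists (Tuple size_s'); last by apply: val_inj.
by rewrite inE /= -cycle_f -sE.
Qed.

(** Inclusion-exclusion: the sum is the expansion of the product over the edges
    e of 1 - [e does not occur in s]. *)
Lemma sum_avoids (R : comNzRingType) s :
  \sum_(A : {set edge G}) (-1) ^+ #|A| * (avoids A s)%:R =
  (covering s)%:R :> R.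
Proof.
pose unused e := ~~ (((e, false) \in s) || ((e, true) \in s)).
have prod_bool (P b : pred (edge G)) :
    \prod_(e | P e) (b e)%:R = [forall (e | P e), b e]%:R :> R.
  have [/forall_inP bP|/forall_inPn[e Pe nbe]] := boolP [forall (e | P e), b e].
    by rewrite big1 // => e /bP ->.
  by rewrite (bigD1 e) //= (negPf nbe) mul0r.
have -> : covering s = [forall (e | true), ~~ unused e].
  by apply: eq_forallb => e; rewrite negbK.
rewrite -prod_bool.
transitivity (\prod_e (- (unused e)%:R + 1 : R)); last first.
  by apply: eq_bigr => e _; case: (unused e); rewrite ?addNr ?oppr0 ?add0r.
rewrite bigA_distr; apply: eq_bigr => A _; rewrite -big_mkcond /=.
under [RHS]eq_bigr do rewrite -mulN1r.
rewrite big_split prodr_const prod_bool; congr (_ * (nat_of_bool _)%:R).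
apply/allP/forall_inP => [av e eA | unA [e b] s_eb].
  by rewrite /unused; apply/norP; split; apply/negP => /av; rewrite eA.
by apply/negP => /unA; rewrite /unused; case: b s_eb => ->; rewrite ?orbT.
Qed.

Lemma omega_sum_trace (R : comNzRingType) N : (0 < N)%N ->
  (omega G N)%:R =
  \sum_(A : {set edge G}) (-1) ^+ #|A| *
     \tr (edge_adjacency (delete_edges A) R ^+ N) :> R.
Proof.
move=> N_gt0.
transitivity (\sum_(A : {set edge G}) \sum_(s : N.-tuple (arc G) |
    path.cycle (@follows G) s) (-1) ^+ #|A| * (avoids A s)%:R : R); last first.
  apply: eq_bigr => A _.
  rewrite (trace_adjacency_exp _ (@follows (delete_edges A))) //.
  rewrite card_cycles_delete; set C := [set _ | _].
  rewrite -[#|C|]sum1_card natr_sum mulr_sumr.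
  rewrite big_mkcond [RHS]big_mkcond; apply: eq_bigr => s _; rewrite inE.
  by case: path.cycle; case: avoids; rewrite //= mulr0.
rewrite exchange_big /omega -sum1_card natr_sum big_mkcond [RHS]big_mkcond.
apply: eq_bigr => s _; rewrite sum_avoids inE /is_cycle size_tuple N_gt0.
by case: path.cycle; case: covering.
Qed.

End CyclesOfGraph.

(** * The three expressions of the product *)

Lemma log_deriv_det_adjacency (G : multigraph) :
  log_deriv (\det (1%:M - fpsX *: edge_adjacency G {fps rat}))
    (FPS (fun n => - \tr (edge_adjacency G rat ^+ n.+1))).
Proof.
have -> : edge_adjacency G {fps rat} =
    map_mx (@fpsC rat) (edge_adjacency G rat).
  by apply/matrixP => i j; rewrite !mxE rmorph_nat.
exact: log_deriv_det_1subXmx.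
Qed.

Section Series.
Variables (G : multigraph) (s : int).

Lemma signed_h_seriesE n :
  (- (s%:~R * h_series G)) n.+1 = - (s%:~R * ((omega G n.+1)%:R / n.+1%:R)).
Proof. by rewrite fpsNE mulrzl fpsMzE -mulrzl. Qed.

Lemma signed_h_series0 : (- (s%:~R * h_series G)) 0%N = 0.
Proof. by rewrite fpsNE mulrzl fpsMzE /= mul0rz oppr0. Qed.

Lemma deriv_signed_h_series n :
  fps_deriv (- (s%:~R * h_series G)) n = - (omega G n.+1)%:R *~ s.
Proof.
rewrite -[LHS]/(n.+1%:R * (- (s%:~R * h_series G)) n.+1) signed_h_seriesE.
rewrite mulrN mulrCA [n.+1%:R * _]mulrC divfK ?pnatr_eq0 //.
by rewrite mulrzl mulNrz.
Qed.

Lemma exp_signed_h_series_cycle_product :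
  fps_cvg
    (fun M => \prod_(1 <= N < M.+1) (1 - fpsX ^+ N) ^ (s * (Theta G N)%:Z))
    (fps_exp (- (s%:~R * h_series G))).
Proof.
move=> n; exists n => M le_nM.
pose L N : {fps rat} := FPS (fun k => - (if (N %| k.+1)%N then N%:R else 0)).
have prodL : log_deriv
    (\prod_(1 <= N < M.+1) (1 - fpsX ^+ N) ^ (s * (Theta G N)%:Z) : {fps rat})
    (\sum_(1 <= N < M.+1) L N *~ (s * (Theta G N)%:Z)).
  rewrite big_nat [X in log_deriv _ X]big_nat.
  apply: log_deriv_prod => N /andP[N_gt0 _].
  exact/log_deriv_exprz/log_deriv_1subXn.
apply: (log_deriv_eqmod prodL (log_deriv_exp signed_h_series0)) (ltnSn n).
move=> m lt_mn.
rewrite deriv_signed_h_series omega_sum_Theta // fps_sumE.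
(* A factor of index N > m + 1 does not contribute to the coefficient m, since
   N then does not divide m + 1. *)
rewrite [in LHS](@big_cat_nat _ _ _ m.+2) //= ?ltnS ?(leq_trans lt_mn) //.
rewrite [X in _ + X]big_nat [X in _ + X]big1 ?addr0 => [|N /andP[lt_mN _]].
  rewrite natr_sum -sumrN mulrz_suml [in RHS]big_mkcond; apply: eq_bigr => N _.
  rewrite fpsMzE /=; case: ifP => _; last by rewrite oppr0 mul0rz.
  by rewrite [s * _]mulrC mulrzA natrM -mulNr mulr_natr pmulrn.
by rewrite fpsMzE /= ifN ?oppr0 ?mul0rz // gtnNdvd.
Qed.

Lemma exp_signed_h_series_det :
  fps_exp (- (s%:~R * h_series G)) =
  \prod_(0 <= k < #|edge G|.+1) \prod_(A : {set edge G} | #|A| == k)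
    (\det (1%:M - fpsX *: edge_adjacency (delete_edges A) {fps rat}))
      ^ (s * (-1) ^+ k).
Proof.
pose L (A : {set edge G}) : {fps rat} :=
  FPS (fun n => - \tr (edge_adjacency (delete_edges A) rat ^+ n.+1)).
apply: log_deriv_inj (log_deriv_exp signed_h_series0) _.
have -> : fps_deriv (- (s%:~R * h_series G)) =
    \sum_(0 <= k < #|edge G|.+1) \sum_(A : {set edge G} | #|A| == k)
      L A *~ (s * (-1) ^+ k).
  transitivity (\sum_(A : {set edge G}) L A *~ (s * (-1) ^+ #|A|)).
    apply: fpsP => n; rewrite deriv_signed_h_series fps_sumE.
    rewrite (omega_sum_trace G rat) // -sumrN mulrz_suml; apply: eq_bigr => A _.
    rewrite fpsMzE [s * _]mulrC mulrzA -mulrN; congr (_ *~ _).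
    by rewrite -mulrzl rmorphXn /= rmorphN1.
  rewrite big_mkord.
  have card_lt (A : {set edge G}) : (#|A| < #|edge G|.+1)%N.
    by rewrite ltnS max_card.
  rewrite (partition_big (fun A => Ordinal (card_lt A)) predT) //=.
  apply: eq_bigr => k _; apply: eq_big => [A|A /eqP <-] //.
apply: log_deriv_prod => k _; apply: log_deriv_prod => A _.
exact/log_deriv_exprz/log_deriv_det_adjacency.
Qed.

End Series.

(** Grouping the tuples by m = a_1 + ... + a_i is harmless because m then lies
    between 1 and i: it is at most the weighted sum i, and nonzero when i is. *)
Lemma d_coefE (G : multigraph) (upper : bool) i : (0 < i)%N ->
  d_coef G upper i =
  \sum_(a : {ffun 'I_i -> 'I_i.+1} | (\sum_(k < i) k.+1 * a k == i)%N)
    lambda upper (\sum_(k < i) a k) *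
      \prod_(k < i) ((omega G k.+1)%:R ^+ a k / ((a k)`!%:R * k.+1%:R ^+ a k)).
Proof.
move=> i_gt0; rewrite /d_coef; under eq_bigr do rewrite mulr_sumr.
rewrite (exchange_big_dep (fun a : {ffun 'I_i -> 'I_i.+1} =>
  (\sum_(k < i) k.+1 * a k == i)%N)) /=; last by move=> m a _ /andP[].
apply: eq_bigr => a /eqP a_i; set m := (\sum_(k < i) a k)%N.
have m_in : m \in index_iota 1 i.+1.
  rewrite mem_index_iota ltnS; apply/andP; split; last first.
    by rewrite -[X in (_ <= X)%N]a_i leq_sum // => k _; rewrite leq_pmull.
  rewrite lt0n; apply: contraTneq i_gt0 => /eqP.
  rewrite sum_nat_eq0 => /forallP a0.
  by rewrite -a_i big1 // => k _; rewrite (eqP (a0 k)) muln0.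
rewrite big_mkcond (bigD1_seq _ m_in (iota_uniq _ _)) /= a_i !eqxx.
rewrite [X in _ + X]big1 ?addr0 // => m'; rewrite eq_sym => /negPf ->.
by rewrite andbF.
Qed.

Lemma exp_signed_h_series_d_series (G : multigraph) (upper : bool) :
  let s : int := if upper then 1 else -1 in
  fps_exp (- (s%:~R * h_series G)) = 1 - s%:~R * d_series G upper.
Proof.
move=> s; apply: fpsP => i; rewrite fpsDE fpsNE [in RHS]mulrzl fpsMzE fps1E.
case: i => [|i].
  by rewrite (log_deriv_exp (signed_h_series0 G s)).1 mul0rz subr0.
rewrite fps_exp_coef ?signed_h_series0 // sub0r.
rewrite -[d_series _ _ _]/(d_coef G upper i.+1).
rewrite d_coefE // mulrz_suml -sumrN; apply: eq_bigr => a _.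
(* - s lambda(m) = (- s)^m for either sign, which is where lambda comes from. *)
have signE m : (- s%:~R) ^+ m = - (s%:~R * lambda upper m) :> rat.
  rewrite /s /lambda; case: upper {s}.
    by rewrite mul1r exprS mulN1r opprK.
  by rewrite mulr1 rmorphN1 opprK expr1n.
rewrite -[in RHS]mulrzl mulrA -[in RHS]mulNr -signE -prodrXr -big_split.
apply: eq_bigr => k _; rewrite signed_h_seriesE -mulNr exprMn expr_div_n.
by rewrite invfM -!mulrA [X in _ * (_ * X)]mulrC.
Qed.

Theorem theorem2p3 (G : multigraph)
    (G_connected : graph_connected G)
    (G_edges : (1 <= #|edge G|)%N)
    (G_degree : forall v : vertex G, degree v != 1%N)
    (upper : bool) :
  let s : int := if upper then 1 else -1 in
  let det_prod : {fps rat} :=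
    \prod_(0 <= k < #|edge G|.+1) \prod_(A : {set edge G} | #|A| == k)
      (\det (1%:M - fpsX *: edge_adjacency (delete_edges A) {fps rat}))
        ^ (s * (-1) ^+ k) in
  [/\ fps_cvg
        (fun M => \prod_(1 <= N < M.+1) (1 - fpsX ^+ N) ^ (s * (Theta G N)%:Z))
        (fps_exp (- (s%:~R * h_series G))),
      fps_exp (- (s%:~R * h_series G)) = det_prod
    & det_prod = 1 - s%:~R * d_series G upper].
Proof.
move=> s det_prod; have expE := exp_signed_h_series_det G s.
split=> //; first exact: exp_signed_h_series_cycle_product.
by rewrite /det_prod -expE; apply: exp_signed_h_series_d_series.
Qed.
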